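(* If there exists an $SHF(4;n,q,\{2,2\})$, then $n=o(q^2)$ as $q\to\infty$. That is, for every $\epsilon>0$ there is $q_0$ such that for every $q\ge q_0$ every $SHF(4;n,q,\{2,2\})$ satisfies $n\le\epsilon q^2$.
   Context: An $SHF(4;n,q,\{2,2\})$ is a $4\times n$ matrix over an alphabet of $q$ symbols such that for any two disjoint sets $C_1,C_2$ of columns with $|C_1|=|C_2|=2$ there is a row which separates them, i.e. in which the set of entries of the columns of $C_1$ is disjoint from the set of entries of the columns of $C_2$. *)

(* Defs.v *)
From mathcomp Require Import all_boot all_order all_algebra.

Set Implicit Arguments.
Unset Strict Implicit.
Unset Printing Implicit Defensive.

Definition separates (N n q : nat) (A : 'M['I_q]_(N, n)) (i : 'I_N)
    (C1 C2 : {set 'I_n}) : bool :=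
  [disjoint [set A i j | j in C1] & [set A i j | j in C2]].

(* [is_SHF w1 w2 A]: A is an SHF(N; n, q, {w1, w2}), the alphabet being 'I_q. *)
Definition is_SHF (w1 w2 N n q : nat) (A : 'M['I_q]_(N, n)) : Prop :=
  forall C1 C2 : {set 'I_n},
    #|C1| = w1 -> #|C2| = w2 -> [disjoint C1 & C2] ->
    exists i : 'I_N, separates A i C1 C2.

(* Main.v *)
(* Erasing O(q) columns leaves a set F of columns in which every occurring
   symbol of a row occurs at least four times. Then two columns a, c of F agree
   in at most one row: if they agreed in two rows, a column b agreeing with c in
   a third row and a column d agreeing with a in the fourth would make {a, b}
   and {c, d} inseparable. For the same reason F has no rainbow cycle, that is,
   no distinct a, c, b, d that cyclically agree in rows 1, 2, 3, 4.

   Let E be the bipartite graph of the pairs (b_2, b_3), b in F. For a in F, let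
   U_a be the second entries of the columns with first entry a_1, and W_a the
   third entries of the columns with fourth entry a_4. Without rainbow cycles E
   has at most 4q edges in U_a x W_a. If |F| >= 8 delta q^2, then for any
   partitions of the two sides, most columns a lie in a cell P x Q which is dense
   and in which U_a and W_a occupy a fraction at least delta of P and Q. Such a
   cell is far from homogeneous, and splitting along the sets U_a, W_a (one a for
   each cell) increases the energy of the partition, as in the proof of the
   regularity lemma, by 2 delta^4 q^2. The energy is at most q^2 and the number
   of parts after a bounded number of steps is bounded, so |F| < 8 delta q^2 for
   q large. *)
Require Import Defs.
From mathcomp Require Import all_boot all_order all_algebra.
From mathcomp Require Import reals ring lra.

Import Order.TTheory GRing.Theory Num.Theory.
Local Open Scope ring_scope.

Set Implicit Arguments.
Unset Strict Implicit.

Section RainbowCycles.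

(** * Energy of a partition *)

Variable R : realFieldType.

(* This is ||1_E||^2 - ||1_E - g||^2, so among the functions that factor through
   pi it is maximised by the density. *)
Definition fit (T : finType) (E : {set T}) (g : T -> R) : R :=
  \sum_t ((t \in E)%:R * g t *+ 2 - g t ^+ 2).

Definition density (T I : finType) (E : {set T})
    (pi : T -> I) (c : I) : R :=
  #|[set t in E | pi t == c]|%:R / #|[set t | pi t == c]|%:R.

Definition energy (T I : finType) (E : {set T})
    (pi : T -> I) : R :=
  fit E (fun t => density E pi (pi t)).

(** Pointwise, [2 * g - g ^+ 2 <= 1] on [E] and [- g ^+ 2 <= 0] off [E]. *)
Lemma fit_le_card (T : finType) (E : {set T}) (g : T -> R) :
  fit E g <= #|E|%:R.
Proof.
rewrite /fit cardE -sum1_size big_enum /= natr_sum [leRHS]big_mkcond /=.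
apply: ler_sum => t _; have := sqr_ge0 (g t); have := sqr_ge0 (g t - 1).
by case: (t \in E) => /=; nra.
Qed.

Lemma sum_mem_card (T I : finType) (E : {set T})
    (pi : T -> I) (c : I) :
  \sum_(t | pi t == c) (t \in E)%:R = #|[set t in E | pi t == c]|%:R :> R.
Proof.
by rewrite -natr_sum -sum1dep_card big_mkcondl.
Qed.

Lemma density_mul (T I : finType) (E : {set T})
    (pi : T -> I) (c : I) :
  density E pi c * #|[set t | pi t == c]|%:R = #|[set t in E | pi t == c]|%:R.
Proof.
rewrite /density; set N := #|[set t | pi t == c]|.
(* An empty fibre has density [0 / 0 = 0]. *)
have [N0|N0] := eqVneq N 0%N; last by rewrite divfK ?pnatr_eq0.
rewrite N0 mulr0; suff -> : #|[set t in E | pi t == c]| = 0%N by [].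
apply/eqP; rewrite -leqn0 -N0; apply/subset_leq_card/subsetP => t.
by rewrite !inE => /andP[].
Qed.

Lemma density_ge0 (T I : finType) (E : {set T})
    (pi : T -> I) (c : I) : 0 <= density E pi c.
Proof. exact: divr_ge0. Qed.

(** On a fibre with [N] points and density [d] the two sides differ by [N * (k - d) ^+ 2]. So any
    function constant on the cells bounds the energy from below. *)
Lemma fit_le_energy (T I : finType) (E : {set T})
    (pi : T -> I) (k : I -> R) :
  fit E (fun t => k (pi t)) <= energy E pi.
Proof.
have fitE (h : I -> R) : fit E (fun t => h (pi t)) =
    \sum_c (#|[set t in E | pi t == c]|%:R * h c *+ 2
            - #|[set t | pi t == c]|%:R * h c ^+ 2).
  rewrite /fit (partition_big pi predT) //=; apply: eq_bigr => c _.
  rewrite sumrB (eq_bigr (fun t => (t \in E)%:R * (h c *+ 2))); last first.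
    by move=> t /eqP ->; rewrite mulrnAr.
  rewrite -mulr_suml sum_mem_card mulrnAr; congr (_ - _).
  rewrite (eq_bigr (fun=> h c ^+ 2)) => [|t /eqP -> //].
  by rewrite sumr_const mulr_natl cardsE.
rewrite /energy !fitE; apply: ler_sum => c _.
rewrite -density_mul; set d := density _ _ _; set N := _%:R.
have N0 : 0 <= N by exact: ler0n.
have := mulr_ge0 N0 (sqr_ge0 (k c - d)); nra.
Qed.

(** Zeroing the density pays off when [S] is large but contains few points of [E]: the quadratic
    term then outweighs the linear one. *)
Lemma fit_zero_on (T I : finType) (E S : {set T}) (pi : T -> I) :
  fit E (fun t => if t \in S then 0 else density E pi (pi t)) =
  energy E pi +
    \sum_c (density E pi c ^+ 2 * #|[set t in S | pi t == c]|%:R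
            - density E pi c * #|[set t in E :&: S | pi t == c]|%:R *+ 2).
Proof.
apply/eqP; rewrite addrC -subr_eq; apply/eqP.
rewrite /energy /fit -sumrB (partition_big pi predT) //=.
apply: eq_bigr => c _; rewrite -!sum_mem_card !mulr_sumr -sumrMnl -sumrB.
apply: eq_bigr => t /eqP ->; rewrite inE.
by case: (t \in E); case: (t \in S) => /=; ring.
Qed.

(** * Counting in fibres *)

Lemma card_sum_fibres (T I : finType) (B : {set T}) (f : T -> I) :
  (\sum_i #|[set x in B | f x == i]| = #|B|)%N.
Proof.
rewrite -sum1_card (partition_big f predT) //=.
by apply: eq_bigr => i _; rewrite -sum1dep_card.
Qed.

(** If a fibre contains a counted element, the whole fibre has fewer than [w c] elements in [F]. *)
Lemma card_in_light_fibres (T C : finType) (F : {set T}) (key : T -> C)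
    (w : C -> R) :
  (forall c, 0 <= w c) ->
  #|[set a in F | #|[set c in F | key c == key a]|%:R < w (key a)]|%:R
    <= \sum_c w c.
Proof.
move=> w0; set B := [set a in F | _].
rewrite -(card_sum_fibres B key) natr_sum; apply: ler_sum => c _.
have [->|[a]] := set_0Vmem [set x in B | key x == c]; first by rewrite cards0.
rewrite !inE => /andP[/andP[_ lt_w] /eqP ca].
rewrite -ca; apply/ltW/(le_lt_trans _ lt_w).
rewrite ler_nat; apply/subset_leq_card/subsetP => x.
by rewrite !inE => /andP[/andP[-> _] ->].
Qed.

(** Used for a cell with [N] pairs, [e] edges and density [d], in which [S] has [s] pairs and [es]
    edges. Here [d * s >= delta ^+ 2 * e] and [es <= delta ^+ 2 * e / 4], so half of
    [d * delta ^+ 2 * e] survives, and [d >= delta]. *)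
Lemma heavy_cell_gain (delta d N e s es q : R) :
  0 < delta -> 0 <= d -> 0 <= N -> 0 <= s -> e = d * N -> delta * N <= e ->
  16 * q <= delta ^+ 2 * e -> delta ^+ 2 * N <= s -> es <= 4 * q ->
  delta ^+ 3 / 2 * e <= d ^+ 2 * s - d * es *+ 2.
Proof.
move=> delta0 d0 N0 s0 eE dNe qe Ns esq.
have [N_eq0|N_neq0] := eqVneq N 0.
  have e0 : e = 0 by rewrite eE N_eq0 mulr0.
  rewrite e0 mulr0 in qe *; nra.
have Npos : 0 < N by rewrite lt_neqAle eq_sym N_neq0.
have delta_d : delta <= d by rewrite -(ler_pM2r Npos) -eE.
have e_ge0 : 0 <= e by rewrite eE mulr_ge0.
have ds : delta ^+ 2 * e <= d * s by rewrite eE mulrCA ler_wpM2l.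
have dds : d * (delta ^+ 2 * e) <= d * (d * s) by rewrite ler_wpM2l.
have des : d * es <= d * (delta ^+ 2 * e / 4) by rewrite ler_wpM2l //; lra.
have : delta * (delta ^+ 2 * e) <= d * (delta ^+ 2 * e).
  by rewrite ler_wpM2r // mulr_ge0 // sqr_ge0.
have -> : delta ^+ 3 / 2 * e = delta * (delta ^+ 2 * e) / 2 by ring.
have -> : d ^+ 2 * s = d * (d * s) by ring.
lra.
Qed.

(** * Energy increment without rainbow cycles *)

Section Increment.

Variables (V T : finType) (F : {set T}) (x1 x2 x3 x4 : T -> V).

Hypothesis inj12 : {in F &, injective (fun a => (x1 a, x2 a))}.
Hypothesis inj23 : {in F &, injective (fun a => (x2 a, x3 a))}.
Hypothesis inj34 : {in F &, injective (fun a => (x3 a, x4 a))}.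
Hypothesis inj41 : {in F &, injective (fun a => (x4 a, x1 a))}.
Hypothesis no_cycle : forall a b c d : T,
  a \in F -> b \in F -> c \in F -> d \in F -> uniq [:: a; b; c; d] ->
  x1 a = x1 c -> x2 c = x2 b -> x3 b = x3 d -> x4 d = x4 a -> False.

Local Notation E := [set (x2 b, x3 b) | b in F].
Local Notation U a := [set x2 c | c in F & x1 c == x1 a].
Local Notation W a := [set x3 d | d in F & x4 d == x4 a].

(* An edge between U a and W a comes from a column b that closes a cycle
   a, c, b, d, which must be degenerate; so b agrees with a in some row. *)
Lemma card_edges_neighbourhoods (a : T) :
  a \in F -> (#|E :&: setX (U a) (W a)| <= 4 * #|V|)%N.
Proof.
move=> aF.
pose D (f : T -> V) : {set T} := [set b in F | f b == f a].
have subD : E :&: setX (U a) (W a) \subset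
    [set (x2 b, x3 b) | b in D x1 :|: D x2 :|: D x3 :|: D x4].
  apply/subsetP => t; rewrite !inE => /andP[/imsetP[b bF ->]] /= /andP[].
  move=> /imsetP[c]; rewrite inE => /andP[cF /eqP x1c] x2c.
  move=> /imsetP[d]; rewrite inE => /andP[dF /eqP x4d] x3d.
  apply: imset_f; rewrite !inE bF /=; apply/negPn/negP.
  rewrite !negb_or => /andP[/andP[/andP[b1 b2] b3] b4].
  apply: (no_cycle aF bF cF dF) => //.
  rewrite /= !inE !negb_or !andbT; apply/and3P; split.
  - apply/and3P; split.
    + by apply: contraNneq b1 => ->.
    + by apply: contraNneq b2 => ->; rewrite x2c.
    + by apply: contraNneq b3 => ->; rewrite x3d.
  - apply/andP; split; first by apply: contraNneq b1 => ->; rewrite x1c.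
    by apply: contraNneq b4 => ->; rewrite x4d.
  (* If [c = d], this column agrees with [a] in rows 1 and 4, so it is [a], and then [b] agrees with
     [a] in row 2. *)
  - apply: contraNneq b2 => cd; rewrite x2c; apply/eqP; congr x2.
    by apply: inj41 => //=; rewrite x1c cd x4d.
have cardD (f g : T -> V) :
    {in F &, injective (fun b => (f b, g b))} -> (#|D f| <= #|V|)%N.
  move=> fg; rewrite -(@card_in_imset _ _ g) ?max_card // => b c.
  rewrite !inE => /andP[bF /eqP fb] /andP[cF /eqP fc] gbc.
  by apply: fg => //=; rewrite fb fc gbc.
apply: leq_trans (subset_leq_card subD) _; apply: leq_trans (leq_imset_card _ _) _.
apply: leq_trans (leq_card_setU _ _) _; rewrite mulSn addnC.
apply: leq_add; first exact: cardD inj41.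
apply: leq_trans (leq_card_setU _ _) _; rewrite mulSn addnC.
apply: leq_add; first exact: cardD inj34.
apply: leq_trans (leq_card_setU _ _) _; rewrite mul2n -addnn.
by apply: leq_add; [exact: cardD inj12|exact: cardD inj23].
Qed.

Definition cell (I J : finType) (p : V -> I) (r : V -> J) (t : V * V) : I * J :=
  (p t.1, r t.2).

Lemma card_edges_cell (I J : finType) (p : V -> I) (r : V -> J) (c : I * J) :
  #|[set t in E | cell p r t == c]|
    = #|[set b in F | cell p r (x2 b, x3 b) == c]|.
Proof.
rewrite -(@card_in_imset _ _ (fun b => (x2 b, x3 b)) [set b in F | _]).
  apply: eq_card => t; rewrite !inE; apply/andP/imsetP.
    by case=> /imsetP[b bF ->] tc; exists b => //; rewrite inE bF.
  by case=> b; rewrite inE => /andP[bF bc] ->; split; first exact: imset_f.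
by move=> b b'; rewrite !inE => /andP[bF _] /andP[b'F _]; apply: inj23.
Qed.

Lemma card_cell (I J : finType) (p : V -> I) (r : V -> J) (c : I * J) :
  #|[set t | cell p r t == c]|
    = (#|[set x | p x == c.1]| * #|[set y | r y == c.2]|)%N.
Proof. by rewrite -cardsX; apply: eq_card => -[x y]; rewrite !inE. Qed.

Lemma sum_fibres_const (C I : finType) (p : V -> I) (delta : R) :
  \sum_(c : C * I) delta * #|[set x | p x == c.2]|%:R
    = delta * #|C|%:R * #|V|%:R.
Proof.
rewrite -mulr_sumr -mulrA; congr (_ * _).
rewrite -(pair_big predT predT (fun _ i => #|[set x | p x == i]|%:R)) /=.
rewrite sumr_const -natr_sum mulr_natl -[in RHS]cardsT -(card_sum_fibres _ p).
congr (_%:R *+ _).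
by apply: eq_bigr => i _; apply: eq_card => x; rewrite !inE.
Qed.

Section Step.

Variables (I J : finType) (p : V -> I) (r : V -> J) (delta : R).
Hypothesis delta_gt0 : 0 < delta.
Hypothesis V_large : 16 * (#|I| * #|J|)%:R <= delta ^+ 3 * #|V|%:R.
Hypothesis F_large : 8 * delta * #|V|%:R ^+ 2 <= #|F|%:R.

Let col_cell (a : T) : I * J := cell p r (x2 a, x3 a).
Let left_key (a : T) : V * I := (x1 a, p (x2 a)).
Let right_key (a : T) : V * J := (x4 a, r (x3 a)).

(** By [inj12] and [inj34] the first two counts are the sizes of [U a] and [W a] inside the parts of
    [a]. The last condition makes the [4 * #|V|] edges of [U a] x [W a] negligible in the cell. *)
Definition heavy : {set T} :=
  [set a in F | [&&
    delta * #|[set x | p x == p (x2 a)]|%:R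
      <= #|[set c in F | left_key c == left_key a]|%:R,
    delta * #|[set y | r y == r (x3 a)]|%:R
      <= #|[set c in F | right_key c == right_key a]|%:R,
    delta * #|[set t | cell p r t == col_cell a]|%:R
      <= #|[set c in F | col_cell c == col_cell a]|%:R &
    16 * #|V|%:R / delta ^+ 2 <= #|[set c in F | col_cell c == col_cell a]|%:R]].

(** Each of the four conditions fails for at most [delta * #|V| ^ 2] columns; for the last one this
    is [V_large]. *)
Lemma card_heavy : 4 * delta * #|V|%:R ^+ 2 <= #|heavy|%:R.
Proof.
have delta0 := ltW delta_gt0.
pose light (C : finType) (key : T -> C) (w : C -> R) :=
  [set a in F | #|[set c in F | key c == key a]|%:R < w (key a)].
pose B1 := light _ left_key (fun c => delta * #|[set x | p x == c.2]|%:R).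
pose B2 := light _ right_key (fun c => delta * #|[set y | r y == c.2]|%:R).
pose B3 := light _ col_cell (fun c => delta * #|[set t | cell p r t == c]|%:R).
pose B4 := light _ col_cell (fun=> 16 * #|V|%:R / delta ^+ 2).
have cover : F \subset heavy :|: (B1 :|: B2 :|: (B3 :|: B4)).
  apply/subsetP => a aF; rewrite !inE aF /= !ltNge.
  by do 4 case: (_ <= _) => //=.
have b1 : #|B1|%:R <= delta * #|V|%:R ^+ 2.
  rewrite expr2 mulrA -(sum_fibres_const V p).
  by apply: card_in_light_fibres => c; rewrite mulr_ge0.
have b2 : #|B2|%:R <= delta * #|V|%:R ^+ 2.
  rewrite expr2 mulrA -(sum_fibres_const V r).
  by apply: card_in_light_fibres => c; rewrite mulr_ge0.
have b3 : #|B3|%:R <= delta * #|V|%:R ^+ 2.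
  apply: le_trans (card_in_light_fibres _ _ _) _ => [c|]; first by rewrite mulr_ge0.
  rewrite -mulr_sumr -natr_sum ler_wpM2l // -natrX ler_nat.
  rewrite -mulnn -card_prod -[leqRHS]cardsT -(card_sum_fibres _ (cell p r)).
  by apply: eq_leq; apply: eq_bigr => c _; apply: eq_card => t; rewrite !inE.
have b4 : #|B4|%:R <= delta * #|V|%:R ^+ 2.
  apply: le_trans (card_in_light_fibres _ _ _) _ => [c|].
    by rewrite divr_ge0 ?mulr_ge0 ?sqr_ge0.
  rewrite sumr_const card_prod -[leLHS]mulr_natl mulrA ler_pdivrMr ?exprn_gt0 //.
  have := ler_wpM2r (ler0n R #|V|) V_large; nra.
have : #|F|%:R <= #|heavy|%:R + (#|B1|%:R + #|B2|%:R + (#|B3|%:R + #|B4|%:R)) :> R.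
  rewrite -!natrD ler_nat; apply: leq_trans (subset_leq_card cover) _.
  apply: leq_trans (leq_card_setU _ _) _; rewrite leq_add2l.
  apply: leq_trans (leq_card_setU _ _) _.
  by apply: leq_add; apply: leq_card_setU.
move: b1 b2 b3 b4 F_large.
move: (#|B1|%:R : R) (#|B2|%:R : R) (#|B3|%:R : R) (#|B4|%:R : R) => n1 n2 n3 n4.
lra.
Qed.

Let rep (c : I * J) : option T := [pick a in heavy | col_cell a == c].
Let Urep (c : I * J) : {set V} := if rep c is Some a then U a else set0.
Let Wrep (c : I * J) : {set V} := if rep c is Some a then W a else set0.

(** Each part [i] is cut along the sets [Urep (i, j)] for all [j] at once, so at most
    [#|I| * 2 ^ #|J|] parts arise. *)
Definition refine_left (x : V) : I * {set J} := (p x, [set j | x \in Urep (p x, j)]).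
Definition refine_right (y : V) : J * {set I} := (r y, [set i | y \in Wrep (i, r y)]).

Lemma energy_increment :
  energy E (cell p r) + 2 * delta ^+ 4 * #|V|%:R ^+ 2
    <= energy E (cell refine_left refine_right).
Proof.
have delta0 := ltW delta_gt0.
pose S : {set V * V} :=
  [set t | (t.1 \in Urep (cell p r t)) && (t.2 \in Wrep (cell p r t))].
(* The test function: the old density, set to 0 on [S]. The refined cell of a pair determines
   whether it lies in [S]. *)
pose k (c : (I * {set J}) * (J * {set I})) : R :=
  if (c.2.1 \in c.1.2) && (c.1.1 \in c.2.2) then 0
  else density E (cell p r) (c.1.1, c.2.1).
apply: le_trans (fit_le_energy _ _ k).
have -> : fit E (fun t => k (cell refine_left refine_right t)) =
    fit E (fun t => if t \in S then 0 else density E (cell p r) (cell p r t)).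
  by apply: eq_bigr => t _; rewrite /k /= !inE.
rewrite fit_zero_on lerD2l.
pose e (c : I * J) := #|[set b in F | col_cell b == c]|.
(* The cells with a representative contain all heavy columns, at least [4 * delta * #|V| ^ 2] of
   them, and each column there is worth [delta ^+ 3 / 2]. *)
apply: (@le_trans _ _ (\sum_c (delta ^+ 3 / 2 * (if rep c then (e c)%:R else 0)))).
  rewrite -mulr_sumr.
  have : #|heavy|%:R <= \sum_c (if rep c then (e c)%:R else 0) :> R.
    rewrite -(card_sum_fibres heavy col_cell) natr_sum; apply: ler_sum => c _.
    rewrite /rep; case: pickP => [a _|none].
      rewrite ler_nat; apply/subset_leq_card/subsetP => b.
      by rewrite !inE => /andP[/andP[-> _] ->].
    rewrite lern0 cards_eq0; apply/eqP/setP => b; rewrite [RHS]inE -(none b).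
    by rewrite !inE.
  move=> le_heavy; have gain0 : 0 <= delta ^+ 3 / 2 by rewrite divr_ge0 ?exprn_ge0.
  apply: le_trans (ler_wpM2l gain0 (le_trans card_heavy le_heavy)).
  by rewrite le_eqVlt; apply/orP; left; apply/eqP; field.
apply: ler_sum => c _; rewrite /S.
case rep_c: (rep c) => [a|]; last first.
  rewrite mulr0.
  have -> : [set t in S | cell p r t == c] = set0.
    apply/setP => t; rewrite !inE; apply/negP => /andP[/andP[tU _] /eqP tc].
    by move: tU; rewrite tc /Urep rep_c inE.
  have -> : [set t in E :&: S | cell p r t == c] = set0.
    apply/setP => t; rewrite !inE; apply/negP => /andP[/andP[_ /andP[tU _]] /eqP tc].
    by move: tU; rewrite tc /Urep rep_c inE.
  by rewrite cards0 !mulr0 mul0rn subr0.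
have [a_heavy ac] : a \in heavy /\ col_cell a = c.
  by move: rep_c; rewrite /rep; case: pickP => // a' /andP[a'h /eqP a'c] [<-].
move: a_heavy; rewrite inE ac => /andP[aF /and4P[heavyU heavyW dense_c large_c]].
have [c1 c2] : p (x2 a) = c.1 /\ r (x3 a) = c.2 by rewrite -ac.
have US : #|[set b in F | left_key b == left_key a]| = #|U a :&: [set x | p x == c.1]|.
  rewrite -(@card_in_imset _ _ x2 [set b in F | _]); last first.
    move=> b b'; rewrite !inE => /andP[bF /eqP[xb _]] /andP[b'F /eqP[xb' _]] e2.
    by apply: inj12 => //=; rewrite xb xb' e2.
  apply: eq_card => x; rewrite !inE -c1; apply/imsetP/andP.
    case=> b; rewrite inE => /andP[bF /eqP[xb pb]] ->.
    by rewrite pb eqxx; split=> //; apply: imset_f; rewrite inE bF xb eqxx.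
  case=> /imsetP[b]; rewrite inE => /andP[bF /eqP xb] -> /eqP pb.
  by exists b => //; rewrite inE bF /left_key xb pb eqxx.
have WS : #|[set b in F | right_key b == right_key a]| = #|W a :&: [set y | r y == c.2]|.
  rewrite -(@card_in_imset _ _ x3 [set b in F | _]); last first.
    move=> b b'; rewrite !inE => /andP[bF /eqP[xb _]] /andP[b'F /eqP[xb' _]] e3.
    by apply: inj34 => //=; rewrite xb xb' e3.
  apply: eq_card => x; rewrite !inE -c2; apply/imsetP/andP.
    case=> b; rewrite inE => /andP[bF /eqP[xb pb]] ->.
    by rewrite pb eqxx; split=> //; apply: imset_f; rewrite inE bF xb eqxx.
  case=> /imsetP[b]; rewrite inE => /andP[bF /eqP xb] -> /eqP pb.
  by exists b => //; rewrite inE bF /right_key xb pb eqxx.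
(* Within [c] the set [S] is a rectangle, so its size is the product of the two heavy counts. *)
have -> : [set t in S | cell p r t == c] =
    setX (U a :&: [set x | p x == c.1]) (W a :&: [set y | r y == c.2]).
  apply/setP => -[x y]; rewrite !in_setX !in_setI !in_set /=.
  have [tc|] := eqVneq (cell p r (x, y)) c.
    by rewrite tc /Urep /Wrep rep_c -tc /= !eqxx !andbT.
  rewrite andbF; case: c {c1 c2 ac rep_c heavyU heavyW dense_c large_c US WS} => i j /=.
  move=> tc; apply/esym; apply: contra_neqF tc.
  by move=> /andP[/andP[_ /eqP <-] /andP[_ /eqP <-]].
apply: (@heavy_cell_gain _ _ #|[set t | cell p r t == c]|%:R _ _ _ #|V|%:R) => //.
- exact: density_ge0.
- by rewrite density_mul card_edges_cell.
- by rewrite [leRHS]mulrC -ler_pdivrMr ?exprn_gt0.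
- rewrite card_cell cardsX !natrM -US -WS c1 c2 in heavyU heavyW *.
  rewrite expr2 mulrACA; apply: ler_pM => //; exact: mulr_ge0.
- rewrite -natrM ler_nat; apply: leq_trans (card_edges_neighbourhoods aF).
  apply/subset_leq_card/subsetP => -[x y]; rewrite !in_set.
  case/andP=> /andP[tE /andP[tU tW]] /eqP tc.
  by move: tU tW; rewrite tc /Urep /Wrep rep_c tE => -> ->.
Qed.

End Step.

(** * Iterating the increment *)

Fixpoint parts_bound (m : nat) : nat :=
  if m is k.+1 then (parts_bound k * 2 ^ parts_bound k)%N else 1%N.

Lemma parts_bound_gt0 (m : nat) : (0 < parts_bound m)%N.
Proof. by elim: m => //= m IHm; rewrite muln_gt0 IHm expn_gt0. Qed.

Lemma card_set_type (C : finType) : #|{set C}| = (2 ^ #|C|)%N.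
Proof. by rewrite -[in RHS]cardsT -card_powerset powersetT cardsT. Qed.

Lemma exists_high_energy (delta : R) (m : nat) :
  0 < delta -> 16 * (parts_bound m ^ 2)%:R <= delta ^+ 3 * #|V|%:R ->
  8 * delta * #|V|%:R ^+ 2 <= #|F|%:R ->
  exists (I J : finType) (p : V -> I) (r : V -> J),
    [/\ (#|I| <= parts_bound m)%N, (#|J| <= parts_bound m)%N &
        m%:R * (2 * delta ^+ 4 * #|V|%:R ^+ 2) <= energy E (cell p r)].
Proof.
move=> delta0 + F_large; elim: m => [_|m IHm V_large].
  exists unit, unit, (fun=> tt), (fun=> tt); rewrite card_unit mul0r; split=> //.
  (* The zero function shows that the energy is nonnegative. *)
  apply: le_trans (fit_le_energy _ _ (fun=> 0)).
  by rewrite /fit big1 // => t _; rewrite mulr0 mul0rn expr0n subr0.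
have le_parts : (parts_bound m <= parts_bound m.+1)%N.
  by rewrite /= leq_pmulr // expn_gt0.
have V_large_m : 16 * (parts_bound m ^ 2)%:R <= delta ^+ 3 * #|V|%:R.
  by apply: le_trans V_large; rewrite ler_pM2l ?ltr0n // ler_nat leq_sqr.
have [I [J [p [r [Im Jm en]]]]] := IHm V_large_m.
exists _, _, (refine_left p r delta), (refine_right p r delta).
split; first by rewrite card_prod card_set_type leq_mul // leq_exp2l.
  by rewrite card_prod card_set_type leq_mul // leq_exp2l.
apply: le_trans (energy_increment p r delta0 _ F_large).
  by rewrite -natr1 mulrDl mul1r lerD2r.
apply: le_trans V_large_m; rewrite ler_pM2l ?ltr0n // ler_nat -mulnn.
exact: leq_mul.
Qed.

(** Otherwise [m] increments would push the energy above [#|V| ^ 2], which bounds [#|E|]. *)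
Lemma card_rainbow_cycle_free (delta : R) (m : nat) :
  0 < delta -> 1 < m%:R * (2 * delta ^+ 4) ->
  16 * (parts_bound m ^ 2)%:R <= delta ^+ 3 * #|V|%:R ->
  #|F|%:R < 8 * delta * #|V|%:R ^+ 2.
Proof.
move=> delta0 m_large V_large; rewrite ltNge; apply/negP => F_large.
have [I [J [p [r [_ _ en]]]]] := exists_high_energy delta0 V_large F_large.
have V0 : 0 < #|V|%:R :> R.
  rewrite -(pmulr_rgt0 _ (exprn_gt0 3 delta0)); apply: lt_le_trans V_large.
  by rewrite mulr_gt0 // ltr0n expn_gt0 parts_bound_gt0.
have := le_trans en (fit_le_card E _); apply/negP; rewrite -ltNge.
apply: (@le_lt_trans _ _ (#|V|%:R ^+ 2)).
  by rewrite -natrX ler_nat -mulnn -card_prod max_card.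
by rewrite mulrA ltr_pMl // exprn_gt0.
Qed.

End Increment.
End RainbowCycles.

(** * Thick sets of columns and separation *)

(* Maximise |F| + d * #{(i, v) | symbol v is absent from row i on F}: erasing
   a nonempty class of fewer than d columns would increase this quantity. *)
Lemma exists_thick_subset (T V C : finType) (row : C -> T -> V) (d : nat) :
  exists2 F : {set T}, (#|T| <= #|F| + d * (#|C| * #|V|))%N &
    forall i a, a \in F -> (d <= #|[set b in F | row i b == row i a]|)%N.
Proof.
pose absent (F : {set T}) : {set C * V} :=
  [set iv | [forall b in F, row iv.1 b != iv.2]].
pose phi (F : {set T}) := (#|F| + d * #|absent F|)%N.
have [F _ Fmax] := @arg_maxnP _ [set: T] xpredT phi isT.
exists F => [|i a aF].
  have /= := Fmax setT isT; rewrite {1}/phi cardsT => le_phi.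
  apply: leq_trans (leq_addr _ _) (leq_trans le_phi _).
  by rewrite leq_add2l leq_mul // -card_prod max_card.
rewrite leqNgt; apply/negP => lt_d; set B := [set b in F | _] in lt_d.
have := Fmax (F :\: B) isT; apply/negP; rewrite -ltnNge /phi.
have BF : B \subset F by apply/subsetP => b; rewrite inE => /andP[].
have absentS : (i, row i a) |: absent F \subset absent (F :\: B).
  apply/subsetP => iv; rewrite !inE => /orP[/eqP ->|/forall_inP no_b].
    apply/forall_inP => b /=; rewrite !inE => /andP[+ bF].
    by rewrite bF.
  by apply/forall_inP => b; rewrite inE => /andP[_]; apply: no_b.
have a_absent : (i, row i a) \notin absent F.
  by rewrite inE; apply/forall_inP => /(_ a aF) /=; rewrite eqxx.
have := subset_leq_card absentS; rewrite cardsU1 a_absent add1n => le_absent.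
rewrite -(cardsID B F) (setIidPr BF) addnAC addnC ltn_add2l.
by apply: leq_trans (leq_mul (leqnn d) le_absent); rewrite mulnS ltn_add2r.
Qed.

(** The four agreements are exactly the four pairs between [{a, b}] and [{c, d}]; a row with any of
    them fails to separate these sets. *)
Lemma SHF22_not_covered (n q : nat) (A : 'M['I_q]_(4, n)) (a b c d : 'I_n) :
  is_SHF 2 2 A -> uniq [:: a; b; c; d] ->
  ~ (forall i, [|| A i a == A i c, A i c == A i b, A i b == A i d | A i d == A i a]).
Proof.
move=> shf; rewrite /= !inE !negb_or andbT.
move=> /and3P[/and3P[ab ac ad] /andP[bc bd] cd] cover.
have [||| i sep] := shf [set a; b] [set c; d]; rewrite ?cards2 ?ab ?cd //.
  rewrite -setI_eq0; apply/eqP/setP => x; rewrite !inE.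
  apply/negP => /andP[/orP[]/eqP -> /orP[]/eqP e].
  - by rewrite e eqxx in ac.
  - by rewrite e eqxx in ad.
  - by rewrite e eqxx in bc.
  - by rewrite e eqxx in bd.
have neq x y : x \in [set a; b] -> y \in [set c; d] -> A i x <> A i y.
  move=> xab ycd e; move/disjointFr: sep => /(_ (A i x)).
  by rewrite imset_f // e imset_f // => /(_ isT).
by case/or4P: (cover i) => /eqP e; [apply: (neq a c)|apply: (neq b c)
  |apply: (neq b d)|apply: (neq a d)]; rewrite ?inE ?eqxx ?orbT.
Qed.

Lemma thick_SHF22_agree_once (n q : nat) (A : 'M['I_q]_(4, n)) (F : {set 'I_n})
    (i j : 'I_4) (a c : 'I_n) :
  is_SHF 2 2 A ->
  (forall i a, a \in F -> (4 <= #|[set b in F | A i b == A i a]|)%N) ->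
  i != j -> a \in F -> c \in F -> A i a = A i c -> A j a = A j c -> a = c.
Proof.
move=> shf thick ij aF cF eqi eqj; apply/eqP; apply/negPn/negP => ac.
(* Four columns per class suffice to avoid three given ones, as the choice of [d] below requires. *)
have avoid k (x : 'I_n) (s : seq 'I_n) : (size s < 4)%N -> x \in F ->
    exists2 b, A k b = A k x & b \notin s.
  move=> s4 xF; have /subsetPn[b] : ~~ ([set b in F | A k b == A k x] \subset s).
    apply: contraL (thick k x xF) => sub; rewrite -ltnNge.
    exact: leq_ltn_trans (subset_leq_card sub) (leq_ltn_trans (card_size s) s4).
  by rewrite inE => /andP[_ /eqP]; exists b.
have /cards2P[k [l [_ kl]]] : #|~: [set i; j]| == 2%N.
  by rewrite cardsCs setCK cards2 ij card_ord.
have [b eqk] := avoid k c [:: a; c] isT cF.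
rewrite !inE negb_or => /andP[ba bc].
have [d eql] := avoid l a [:: a; b; c] isT aF.
rewrite !inE !negb_or => /and3P[da db dc].
have abcd : uniq [:: a; b; c; d].
  by rewrite /= !inE !negb_or !andbT ac bc !(eq_sym _ d) da db dc eq_sym ba.
apply: (SHF22_not_covered shf abcd _) => t; have [|] := boolP (t \in [set i; j]).
  by rewrite !inE => /orP[]/eqP ->; rewrite ?eqi ?eqj eqxx.
by rewrite -in_setC kl !inE => /orP[]/eqP ->; rewrite ?eqk ?eql eqxx !orbT.
Qed.

Theorem theorem4p7 (R : realType) (eps : R) (heps : 0 < eps) :
  exists q0 : nat, forall q : nat, (q0 <= q)%N ->
    forall (n : nat) (A : 'M['I_q]_(4, n)),
      is_SHF 2 2 A -> n%:R <= eps * q%:R ^+ 2.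
Proof.
(* Now [8 * delta] is [eps / 2]. The other half of [eps] absorbs the at most [4 * (4 * q)] erased
   columns once [q >= 32 / eps]. *)
pose delta := eps / 16.
have delta0 : 0 < delta by rewrite divr_gt0 ?ltr0n.
pose m := Num.bound (2 * delta ^+ 4)^-1.
have m_large : 1 < m%:R * (2 * delta ^+ 4).
  have d4 : 0 < 2 * delta ^+ 4 by rewrite mulr_gt0 ?exprn_gt0 ?ltr0n.
  rewrite -ltr_pdivrMr // div1r; apply: archi_boundP.
  by rewrite invr_ge0 ltW.
pose K := 16 * (parts_bound m ^ 2)%:R / delta ^+ 3.
exists (maxn (Num.bound K) (Num.bound (32 / eps))) => q; rewrite geq_max.
have bound_le (x : R) : 0 <= x -> (Num.bound x <= q)%N -> x <= q%:R.
  by move=> x0 xq; apply: ltW; apply: lt_le_trans (archi_boundP x0) _; rewrite ler_nat.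
move=> /andP[/bound_le qK /bound_le q32] n A shf.
have {}qK : 16 * (parts_bound m ^ 2)%:R <= delta ^+ 3 * #|'I_q|%:R.
  rewrite card_ord [leRHS]mulrC -ler_pdivrMr ?exprn_gt0 // qK //.
  by apply: divr_ge0; [exact: mulr_ge0|apply/exprn_ge0/ltW].
have {}q32 : 32 <= eps * q%:R.
  by rewrite [leRHS]mulrC -ler_pdivrMr // q32 // divr_ge0 // ltW.
have [F nF thick] := exists_thick_subset (fun i j => A i j) 4.
have agree i j : i != j -> {in F &, injective (fun a => (A i a, A j a))}.
  move=> ij a c aF cF [eqi eqj].
  exact: thick_SHF22_agree_once shf thick ij aF cF eqi eqj.
have r01 : (inord 0 : 'I_4) != inord 1 by rewrite -val_eqE /= !inordK.
have r12 : (inord 1 : 'I_4) != inord 2 by rewrite -val_eqE /= !inordK.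
have r23 : (inord 2 : 'I_4) != inord 3 by rewrite -val_eqE /= !inordK.
have r30 : (inord 3 : 'I_4) != inord 0 by rewrite -val_eqE /= !inordK.
have no_cycle a b c d : a \in F -> b \in F -> c \in F -> d \in F ->
    uniq [:: a; b; c; d] -> A (inord 0) a = A (inord 0) c ->
    A (inord 1) c = A (inord 1) b -> A (inord 2) b = A (inord 2) d ->
    A (inord 3) d = A (inord 3) a -> False.
  move=> _ _ _ _ abcd e0 e1 e2 e3; apply: (SHF22_not_covered shf abcd _) => i.
  rewrite -[i]inord_val; case: i => -[|[|[|[|//]]]] i4 /=.
  - by rewrite e0 eqxx.
  - by rewrite e1 eqxx orbT.
  - by rewrite e2 eqxx !orbT.
  - by rewrite e3 eqxx !orbT.
have := card_rainbow_cycle_free (agree _ _ r01) (agree _ _ r12) (agree _ _ r23)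
  (agree _ _ r30) no_cycle delta0 m_large qK.
move: nF; rewrite !card_ord -(ler_nat R) natrD !natrM /delta => nF F_small.
have : 32 * q%:R <= eps * q%:R * q%:R by rewrite ler_wpM2r.
lra.
Qed.
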